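(* Let $\check{\mathcal{C}}$ be a minimal modular extension of a super-modular category $\mathcal{C}$ with fermion $\psi$, and let $r:\mathrm{Aut}_{LR}(\check{\mathcal{C}})\to\mathrm{Aut}_{LR}(\mathcal{C})$ be the restriction map. Suppose that the modular $S$-matrix of $\check{\mathcal{C}}$, when restricted to its block involving only $v$-type vortices, is block diagonal with $k$ decoupled blocks. If $[\rho]\in\ker r$ and $x$ is a fermion parity vortex, then $\rho(x)=x\times\psi^{q(x)}$ for some $q(x)\in\{0,1\}$, where, for $v$-type vortices $x$, $q(x)$ is independent of $x$ within a block.
   Context: A super-modular category $\mathcal{C}$ is a unitary braided fusion category with exactly one nontrivial simple object $\psi$ that braids trivially with all objects, where $\psi$ is a fermion: $\theta_\psi=-1$, $\psi\times\psi=1$. A minimal modular extension $\check{\mathcal{C}}$ is a UMTC containing $\mathcal{C}$ as a full braided fusion subcategory, with $\mathcal{D}_{\check{\mathcal{C}}}^2=2\mathcal{D}_{\mathcal{C}}^2$. It is graded, $\check{\mathcal{C}}=\check{\mathcal{C}}_0\oplus\check{\mathcal{C}}_1$, according to whether the double braid $M_{a,\psi}$ is $+1$ or $-1$, and $\check{\mathcal{C}}_0=\mathcal{C}$. Simple objects of $\check{\mathcal{C}}_1$ are called fermion parity vortices; a vortex $x$ is $v$-type if $x\times\psi\neq x$ and $\sigma$-type if $x\times\psi=x$. The decoupled blocks of the $v$-$v$ part of the $S$-matrix are the equivalence classes of $v$-type vortices under the equivalence relation generated by $x\sim y$ whenever $S_{x,y}\neq0$. For $\mathcal{B}=\mathcal{C}$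 or $\check{\mathcal{C}}$, $\mathrm{Aut}_{LR}(\mathcal{B})$ is the group of topological autoequivalences of $\mathcal{B}$ (braided autoequivalences and braided anti-autoequivalences) that fix $\psi$ and act trivially on the fusion vertex $|\psi,\psi;1\rangle$, modulo natural isomorphisms $|a,b;c;\mu\rangle\mapsto\frac{\gamma_a\gamma_b}{\gamma_c}|a,b;c;\mu\rangle$, $\gamma_a\in\mathrm{U}(1)$, with $\gamma_\psi=+1$. The map $r$ restricts an autoequivalence of $\check{\mathcal{C}}$ to $\mathcal{C}$, and $\rho(x)$ denotes the image of the simple object $x$ under the permutation action of $\rho$. *)

(* Defs.v *)
From HB Require Import structures.
From mathcomp Require Import all_boot all_order all_algebra.
Set Implicit Arguments.
Unset Strict Implicit.
Unset Printing Implicit Defensive.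
Import Order.TTheory GRing.Theory Num.Theory.
Local Open Scope ring_scope.
Local Open Scope sesquilinear_scope.

(* Unitary fusion and braided categories are given by their skeletal data.
   For simple objects a, b, c the fusion vertices |a,b;c,m>, m < N a b c, are an
   orthonormal basis of Hom(c, a (x) b), and

     |a,b;e,i> |e,c;d,j> =
        \sum_(f, m, n) Fsym a b c d e f i j m n  |b,c;f,m> |a,f;d,n>
     beta_(a,b) |a,b;c,i> = \sum_j Rsym a b c i j  |b,a;c,j>.                 *)
Definition fusion_rules (I : finType) := I -> I -> I -> nat.

Definition Fdata (K : numClosedFieldType) (I : finType)
    (N : fusion_rules I) :=
  forall a b c d e f : I,
    'I_(N a b e) -> 'I_(N e c d) -> 'I_(N b c f) -> 'I_(N a f d) -> K.

Definition Rdata (K : numClosedFieldType) (I : finType)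
    (N : fusion_rules I) :=
  forall a b c : I, 'M[K]_(N a b c, N b a c).

(* The two ways from ((ab)c)d to a(b(cd)), inside total charge e:
   ab -> f, fc -> g, gd -> e  versus  cd -> l, bl -> k, ak -> e. *)
Definition pentagon (K : numClosedFieldType) (I : finType)
    (N : fusion_rules I) (F : Fdata K N) : Prop :=
  forall (a b c d e f g k l : I)
    (i1 : 'I_(N a b f)) (i2 : 'I_(N f c g)) (i3 : 'I_(N g d e))
    (j1 : 'I_(N c d l)) (j2 : 'I_(N b l k)) (j3 : 'I_(N a k e)),
  \sum_(n < N f l e) F f c d e g l i2 i3 j1 n * F a b l e f k i1 n j2 j3
  = \sum_(h : I) \sum_(s < N b c h) \sum_(t < N a h g) \sum_(u < N h d k)
      F a b c g f h i1 i2 s t * F a h d e g k t i3 u j3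
      * F b c d k h l s u j1 j2.

(* The two ways from (ab)c to b(ca), inside total charge d, moving a past
   b and c; X a b c is the matrix on vertices of the exchange ab -> ba. *)
Definition hexagon (K : numClosedFieldType) (I : finType)
    (N : fusion_rules I) (F : Fdata K N) (X : Rdata K N) : Prop :=
  forall (a b c d e f : I)
    (i1 : 'I_(N a b e)) (i2 : 'I_(N e c d))
    (j1 : 'I_(N c a f)) (j2 : 'I_(N b f d)),
  \sum_(s < N b a e) \sum_(t < N a c f)
     X a b e i1 s * F b a c d e f s i2 t j2 * X a c f t j1
  = \sum_(g : I) \sum_(s < N b c g) \sum_(t < N a g d) \sum_(u < N g a d)
     F a b c d e g i1 i2 s t * X a g d t u * F b c a d g f s u j1 j2.

Record ubfc (K : numClosedFieldType) := UBFC {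
  simple :> finType;
  one : simple;
  dual : simple -> simple;
  fusN : fusion_rules simple;
  Fsym : Fdata K fusN;
  Rsym : Rdata K fusN;

  fusN1l : forall a b : simple, fusN one a b = (b == a);
  fusN1r : forall a b : simple, fusN a one b = (b == a);
  fusN_dual : forall a b : simple, fusN a b one = (b == dual a);

  Fsym_unitary_row : forall (a b c d e e' : simple)
      (i : 'I_(fusN a b e)) (j : 'I_(fusN e c d))
      (i' : 'I_(fusN a b e')) (j' : 'I_(fusN e' c d)),
    \sum_(f : simple) \sum_(m < fusN b c f) \sum_(n < fusN a f d)
       Fsym i j m n * (Fsym i' j' m n)^*
    = [&& e == e', i == i' :> nat & j == j' :> nat]%:R;
  Fsym_unitary_col : forall (a b c d f f' : simple)
      (m : 'I_(fusN b c f)) (n : 'I_(fusN a f d))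
      (m' : 'I_(fusN b c f')) (n' : 'I_(fusN a f' d)),
    \sum_(e : simple) \sum_(i < fusN a b e) \sum_(j < fusN e c d)
       Fsym i j m n * (Fsym i j m' n')^*
    = [&& f == f', m == m' :> nat & n == n' :> nat]%:R;
  Fsym_pentagon : pentagon Fsym;

  (* The vertices |1,a;a> and |a,1;a> are the unit isomorphisms. *)
  Fsym_unit_l : forall (b c d e f : simple)
      (i : 'I_(fusN one b e)) (j : 'I_(fusN e c d))
      (m : 'I_(fusN b c f)) (n : 'I_(fusN one f d)),
    Fsym i j m n = (j == m :> nat)%:R;
  Fsym_unit_m : forall (a c d e f : simple)
      (i : 'I_(fusN a one e)) (j : 'I_(fusN e c d))
      (m : 'I_(fusN one c f)) (n : 'I_(fusN a f d)),
    Fsym i j m n = (j == n :> nat)%:R;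
  Fsym_unit_r : forall (a b d e f : simple)
      (i : 'I_(fusN a b e)) (j : 'I_(fusN e one d))
      (m : 'I_(fusN b one f)) (n : 'I_(fusN a f d)),
    Fsym i j m n = (i == n :> nat)%:R;

  (* Rigidity: the zigzag of a and its dual does not vanish.  All four indices
     range over one-element types. *)
  Fsym_rigid : forall (a : simple)
      (i : 'I_(fusN a (dual a) one)) (j : 'I_(fusN one a a))
      (m : 'I_(fusN (dual a) a one)) (n : 'I_(fusN a one a)),
    Fsym i j m n != 0;

  Rsym_unitary : forall a b c : simple, Rsym a b c \is unitarymx;
  Rsym_hexagon : hexagon Fsym Rsym;
  (* the inverse braiding *)
  Rsym_hexagonV : hexagon Fsym (fun a b c => (Rsym b a c)^t*)
}.

Section Invariants.
Variables (K : numClosedFieldType) (B : ubfc K).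
Implicit Types a b c : B.

(* d_a = 1 / |[F^(a,a^-,a)_a]_(1,1)|; the sum has a single term. *)
Definition zigzag a : K :=
  \sum_(i < fusN a (dual a) (one B)) \sum_(j < fusN (one B) a a)
  \sum_(m < fusN (dual a) a (one B)) \sum_(n < fusN a (one B) a)
     Fsym i j m n.
Definition qdim a : K := `|zigzag a|^-1.

Definition total_dim2 : K := \sum_a qdim a ^+ 2.
Definition total_dim : K := sqrtC total_dim2.

Definition twist a : K := (qdim a)^-1 * \sum_c qdim c * \tr (Rsym a a c).

Definition double_braid a b c : 'M[K]_(fusN a b c) :=
  Rsym a b c *m Rsym b a c.

Definition transparent a : Prop := forall b c, double_braid a b c = 1%:M.

(* The Hopf link: the quantum trace of the double braid of a^- and b. *)
Definition Smatrix a b : K :=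
  total_dim^-1 * \sum_c qdim c * \tr (double_braid (dual a) b c).

Definition modular : Prop :=
  (\matrix_(i < #|B|, j < #|B|) Smatrix (enum_val i) (enum_val j))
    \in unitmx.

(* a (x) b is isomorphic to the simple object c *)
Definition fuses_to a b c : bool := [forall c', fusN a b c' == (c' == c)].

Definition super_modular (psi : B) : Prop :=
  [/\ psi != one B,
      forall a, transparent a <-> a = one B \/ a = psi,
      twist psi = -1
    & fuses_to psi psi (one B)].

Variable psi : B.

Definition psi_pow (q : bool) : B := if q then psi else one B.

Definition vortex a : bool := [forall c, double_braid a psi c == (-1)%:M].
Definition sigma_type a : bool := vortex a && fuses_to a psi a.
Definition v_type a : bool := vortex a && ~~ fuses_to a psi a.

Definition vv_link : rel B := fun a b =>
  [&& v_type a, v_type b & (Smatrix a b != 0) || (Smatrix b a != 0)].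
Definition same_block : rel B := connect vv_link.
Definition vv_blocks : {set {set B}} :=
  equivalence_partition same_block [set a | v_type a].

End Invariants.

(* A unitary functor F, complex linear or antilinear, with
     F |a,b;c,i> = \sum_j vmap a b c i j |F a, F b; F c, j>.                  *)
Record functor_data (K : numClosedFieldType) (B B' : ubfc K) := FunctorData {
  obj :> B -> B';
  anti : bool;
  vmap : forall a b c : B,
    'M[K]_(fusN a b c, fusN (obj a) (obj b) (obj c))
}.

Definition conj_if (K : numClosedFieldType) (t : bool) (z : K) : K :=
  if t then z^* else z.

Section Functors.
Variable K : numClosedFieldType.

(* Full, injective on simple objects, and a braided monoidal functor (if
   [anti] is false) or a braided monoidal antilinear functor (if it is true). *)
Record braided_embedding (B B' : ubfc K) (G : functor_data B B') : Prop := {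
  obj_inj : injective G;
  obj_one : G (one B) = one B';
  obj_fus : forall (a b : B) (c' : B'),
    fusN (G a) (G b) c' != 0%N -> exists c, c' = G c;
  vmap_unitary : forall a b c : B,
    vmap G a b c *m (vmap G a b c)^t* = 1%:M /\
    (vmap G a b c)^t* *m vmap G a b c = 1%:M;
  vmap_unit : forall a : B,
    (forall i j, vmap G (one B) a a i j = 1) /\
    (forall i j, vmap G a (one B) a i j = 1);
  vmap_Fsym : forall (a b c d e f : B)
      (i : 'I_(fusN a b e)) (j : 'I_(fusN e c d))
      (m' : 'I_(fusN (G b) (G c) (G f))) (n' : 'I_(fusN (G a) (G f) (G d))),
    \sum_i' \sum_j' vmap G a b e i i' * vmap G e c d j j' * Fsym i' j' m' n'
    = \sum_m \sum_n conj_if (anti G) (Fsym i j m n)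
        * vmap G b c f m m' * vmap G a f d n n';
  vmap_Rsym : forall a b c : B,
    vmap G a b c *m Rsym (G a) (G b) (G c)
    = map_mx (conj_if (anti G)) (Rsym a b c) *m vmap G b a c
}.

Definition id_functor (B : ubfc K) : functor_data B B :=
  @FunctorData K B B id false (fun a b c => 1%:M).

Definition comp_functor (B B' B'' : ubfc K)
    (G : functor_data B' B'') (H : functor_data B B') : functor_data B B'' :=
  @FunctorData K B B'' (G \o H) (anti G (+) anti H)
    (fun a b c => map_mx (conj_if (anti G)) (vmap H a b c)
                    *m vmap G (H a) (H b) (H c)).

(* G and H differ by the natural isomorphism
   |a,b;c,i> |-> (g a * g b / g c) |a,b;c,i>.  The indices j and j' live in types
   that are equal only up to the equality of G and H on simple objects. *)
Definition differ_by (B B' : ubfc K) (g : B -> K) (G H : functor_data B B') :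
    Prop :=
  [/\ anti G = anti H,
      forall a, G a = H a
    & forall (a b c : B) (i : 'I_(fusN a b c))
        (j : 'I_(fusN (G a) (G b) (G c))) (j' : 'I_(fusN (H a) (H b) (H c))),
        j = j' :> nat ->
        vmap G a b c i j = g a * g b / g c * vmap H a b c i j'].

(* Representatives of the elements of Aut_LR(B).  An embedding of B into itself
   is an autoequivalence, since B has finitely many simple objects. *)
Record autLR (B : ubfc K) (psi : B) (rho : functor_data B B) : Prop := {
  autLR_braided : braided_embedding rho;
  autLR_psi : rho psi = psi;
  autLR_vertex : forall i j, vmap rho psi psi (one B) i j = 1
}.

(* [rho] = [rho'] in Aut_LR(B) *)
Definition eqLR (B : ubfc K) (psi : B) (rho rho' : functor_data B B) : Prop :=
  exists g : B -> K,
    [/\ forall a, `|g a| = 1, g psi = 1 & differ_by g rho rho'].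

Record minimal_modular_extension (C : ubfc K) (psi : C) (Cv : ubfc K)
    (iota : functor_data C Cv) : Prop := {
  ext_super_modular : super_modular psi;
  ext_modular : modular Cv;
  ext_embedding : braided_embedding iota;
  ext_linear : anti iota = false;
  ext_minimal : total_dim2 Cv = 2 * total_dim2 C
}.

(* rho' is the restriction of rho along iota: rho o iota = iota o rho'.  It is
   determined by rho, because iota is injective on objects and unitary. *)
Definition restricts_to (C Cv : ubfc K) (iota : functor_data C Cv)
    (rho : functor_data Cv Cv) (rho' : functor_data C C) : Prop :=
  differ_by (fun=> 1) (comp_functor rho iota) (comp_functor iota rho').

Definition in_ker_r (C : ubfc K) (psi : C) (Cv : ubfc K)
    (iota : functor_data C Cv) (rho : functor_data Cv Cv) : Prop :=
  exists rho' : functor_data C C,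
    [/\ autLR psi rho', restricts_to iota rho rho'
      & eqLR psi rho' (id_functor C)].

End Functors.

(* Main.v *)
(** Let [eps a = +1] or [-1] be the double braid of [a] with the fermion [psi].

    The class [rho] is trivial on [C], so [rho] is complex linear, fixes every
    simple object of [C] and preserves the S-matrix [S] of the extension.  Hence
    the columns [x] and [rho x] of [S] agree on [C].  Now [C] is exactly
    [{a | eps a = 1}]: it is contained in that set, and both have half of the
    total dimension, because [\sum_a eps a * d_a ^+ 2 = 0].  Since
    [S a (psi x) = eps a * S a x], the columns of [x] and [psi x] add up to
    twice the part of column [x] supported on [C].  So the columns of [x] and
    [psi x] and those of [rho x] and [psi (rho x)] have the same sum, and as [S]
    is invertible, [rho x] is [x] or [psi x].  If [S x y != 0] for vortices [x]
    and [y], then [S (rho x) (rho y) = S x y] forces equal powers of [psi], as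
    replacing one of [x], [y] by its product with [psi] changes the sign of [S].

    With [a'] the dual of [a], the dimensions [d_a = 1 / |F^{a a' a}_a|] are shown to be
    multiplicative by computing, from the pentagon, the norm of
    [F^{p q q'}_p] in the trivial channel, and the action of [psi] on [S]
    comes from a trace form of the hexagons. *)

Require Import Defs.
From HB Require Import structures.
From mathcomp Require Import all_boot all_order all_algebra.
From mathcomp Require Import ring.
From mathcomp Require Import reals.
From mathcomp.real_closed Require Import complex.
Import Defs.
Set Implicit Arguments.
Unset Strict Implicit.
Unset Printing Implicit Defensive.
Import Order.TTheory GRing.Theory Num.Theory.
Local Open Scope ring_scope.
Local Open Scope sesquilinear_scope.

Lemma ord_inj1 n (n_le1 : (n <= 1)%N) (i j : 'I_n) : i = j.
Proof.
by case: n n_le1 i j => [|[|//]] _ i j; [case: i | rewrite (ord1 i) (ord1 j)].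
Qed.

Lemma sum_ord_le1 (V : nmodType) n (n_le1 : (n <= 1)%N) (i0 : 'I_n)
    (G : 'I_n -> V) : \sum_i G i = G i0.
Proof.
rewrite (bigD1 i0) //= big1 ?addr0 // => i /eqP[].
exact: ord_inj1.
Qed.

(** * Gram matrices *)

Section HermitianMatrices.
Variable K : numClosedFieldType.

Lemma trmxCE m n (A : 'M[K]_(m, n)) i j : A^t* i j = (A j i)^*.
Proof. by rewrite !mxE. Qed.

Lemma mxtrace_mulC_ge0 m n (A : 'M[K]_(m, n)) : 0 <= \tr (A *m A^t*).
Proof.
apply: sumr_ge0 => i _; rewrite mxE; apply: sumr_ge0 => j _.
by rewrite trmxCE mul_conjC_ge0.
Qed.

Lemma mxtrace_mulC_eq0 m n (A : 'M[K]_(m, n)) : \tr (A *m A^t*) = 0 -> A = 0.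
Proof.
move=> /eqP; rewrite psumr_eq0 => [/allP A0|i _]; last first.
  by rewrite mxE; apply: sumr_ge0 => j _; rewrite trmxCE mul_conjC_ge0.
apply/matrixP => i j; rewrite mxE; have := A0 i; rewrite mem_index_enum => /(_ isT).
rewrite mxE psumr_eq0 => [/allP/(_ j)|k _]; last first.
  by rewrite trmxCE mul_conjC_ge0.
by rewrite mem_index_enum => /(_ isT); rewrite trmxCE mul_conjC_eq0 => /eqP.
Qed.

Lemma trmxC_mul m n p (A : 'M[K]_(m, n)) (B : 'M[K]_(n, p)) :
  (A *m B)^t* = B^t* *m A^t*.
Proof. by rewrite trmx_mul map_mxM. Qed.

Lemma trmxC_scalar n (c : K) : (c%:M : 'M[K]_n)^t* = (c^*)%:M.
Proof. by rewrite tr_scalar_mx map_scalar_mx. Qed.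

(* [P := A^t* *m A] equals [c *: V^t*], so [P *m P = `|c| ^+ 2]; being positive,
   [P] is then the scalar [`|c|]: for [D := P - `|c|] one gets
   [D *m P *m D = - `|c| *: D *m D^t*], of nonnegative and of nonpositive trace. *)
Lemma gram_scalar m n (A : 'M[K]_(m, n)) (V : 'M[K]_n) (c : K) :
    m = n -> V \is unitarymx -> c != 0 -> A *m V *m A^t* = c%:M ->
  A^t* *m A = (`|c|)%:M.
Proof.
move=> emn; case: n / emn A V => A V /unitarymxP VV c0 AVA.
set k := `|c|; set P := A^t* *m A.
have k0 : 0 < k by rewrite normr_gt0.
have PV : P *m V = c%:M.
  have /mulmx1C : (c^-1 *: (A *m V)) *m A^t* = 1%:M.
    by rewrite -scalemxAl AVA scale_scalar_mx mulVf.
  rewrite -scalemxAr mulmxA => /(congr1 (fun M => c *: M)).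
  by rewrite scalerA mulfV // scale1r scalemx1.
have Pd : P^t* = P by rewrite trmxC_mul trmxCK.
have PE : P = c *: V^t*.
  by rewrite -[P]mulmx1 -VV mulmxA PV mul_scalar_mx.
have PP : P *m P = (k ^+ 2)%:M.
  rewrite -{2}Pd {2}PE -mul_scalar_mx trmxC_mul trmxCK trmxC_scalar mulmxA PV.
  by rewrite -scalar_mxM normCK.
pose D := P - k%:M.
have Dd : D^t* = D.
  by rewrite /D linearB /= map_mxB Pd trmxC_scalar conj_Creal // ger0_real ?ltW.
have DP : D *m P = - k *: D.
  by rewrite /D mulmxBl PP mul_scalar_mx scaleNr scalerBr opprB scale_scalar_mx -expr2.
have D0 : \tr (D *m D^t*) = 0.
  apply/eqP; rewrite eq_le mxtrace_mulC_ge0 andbT.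
  have := mxtrace_mulC_ge0 (D *m A^t*).
  rewrite trmxC_mul trmxCK mulmxA -[_ *m A]mulmxA DP -scalemxAl mxtraceZ Dd.
  by rewrite mulNr oppr_ge0 pmulr_rle0.
by apply/eqP; rewrite -subr_eq0; apply/eqP/(mxtrace_mulC_eq0 D0).
Qed.

End HermitianMatrices.

Lemma ord_gt0 n (i : 'I_n) : (0 < n)%N.
Proof. exact: leq_ltn_trans (ltn_ord i). Qed.

(** * Sums over fusion trees *)

Section TreeSums.
Variables (I : finType) (V : nmodType).
Implicit Types m n : I -> nat.

(** The dependent pair packs a channel with its two vertices, so that nested dependent sums can be
    exchanged by [exchange_big]. *)
Lemma sum_tree m n (G : forall f, 'I_(m f) -> 'I_(n f) -> V) :
  \sum_f \sum_(i < m f) \sum_(j < n f) G f i j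
  = \sum_(x : {f : I & ('I_(m f) * 'I_(n f))%type})
      G (tag x) (tagged x).1 (tagged x).2.
Proof.
under eq_bigr do rewrite pair_bigA /=.
by rewrite (sig_big_dep _ _ (fun f p => G f p.1 p.2)).
Qed.

Lemma sum_tree_only m n f0 (G : forall f, 'I_(m f) -> 'I_(n f) -> V) :
    (forall f, (0 < m f)%N -> (0 < n f)%N -> f = f0) ->
  \sum_f \sum_(i < m f) \sum_(j < n f) G f i j
  = \sum_(i < m f0) \sum_(j < n f0) G f0 i j.
Proof.
move=> only; rewrite (bigD1 f0) //= [X in _ + X]big1 ?addr0 // => f /eqP nf.
apply: big1 => i _; apply: big1 => j _.
by case: nf; apply: only; [apply: ord_gt0 i | apply: ord_gt0 j].
Qed.

End TreeSums.

(** * Fusion rules and pentagons *)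

Section Fusion.
Variables (K : numClosedFieldType) (B : ubfc K).
Implicit Types a b c d e f g h : B.

(** A rectangular matrix with [R *m R^t* = 1] has at least as many columns as rows; exchanging the
    objects gives the reverse inequality. *)
Lemma fusNC a b c : fusN a b c = fusN b a c.
Proof.
have le x y : (fusN x y c <= fusN y x c)%N.
  by have /unitarymxP/mulmx1_min := Rsym_unitary x y c.
by apply/eqP; rewrite eqn_leq !le.
Qed.

Lemma dualK : involutive (@dual K B).
Proof.
move=> a; have := fusN_dual (dual a) a; rewrite fusNC fusN_dual eqxx.
by case: eqP.
Qed.

Lemma fusN_one_gt0 a b : (0 < fusN a b (one B))%N -> b = dual a.
Proof. by rewrite fusN_dual; case: eqP. Qed.

Lemma fusN_one_gt0C a b : (0 < fusN a b (one B))%N -> a = dual b.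
Proof. by rewrite fusNC => /fusN_one_gt0. Qed.

Lemma fusN1l_gt0 a b : (0 < fusN (one B) a b)%N -> b = a.
Proof. by rewrite fusN1l; case: eqP. Qed.

Lemma fusN1r_gt0 a b : (0 < fusN a (one B) b)%N -> b = a.
Proof. by rewrite fusN1r; case: eqP. Qed.

Lemma fusN_one_le1 a b : (fusN a b (one B) <= 1)%N.
Proof. by rewrite fusN_dual leq_b1. Qed.

Lemma fusN1l_le1 a b : (fusN (one B) a b <= 1)%N.
Proof. by rewrite fusN1l leq_b1. Qed.

Lemma fusN1r_le1 a b : (fusN a (one B) b <= 1)%N.
Proof. by rewrite fusN1r leq_b1. Qed.

Lemma dual_vertex a : 'I_(fusN a (dual a) (one B)).
Proof. by rewrite fusN_dual eqxx; exact: ord0. Qed.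

Lemma dual_vertex' a : 'I_(fusN (dual a) a (one B)).
Proof. by rewrite fusNC; exact: dual_vertex. Qed.

Lemma unitl_vertex a : 'I_(fusN (one B) a a).
Proof. by rewrite fusN1l eqxx; exact: ord0. Qed.

Lemma unitr_vertex a : 'I_(fusN a (one B) a).
Proof. by rewrite fusN1r eqxx; exact: ord0. Qed.

(** Both sides equal the sum of the squared moduli of the entries of the unitary [F^{abc}_d], taken
    by rows and by columns. *)
Lemma fusNA a b c d :
  (\sum_e fusN a b e * fusN e c d = \sum_f fusN b c f * fusN a f d)%N.
Proof.
apply/eqP; rewrite -(eqr_nat K).
have cntE (x y : B -> nat) :
    (\sum_e x e * y e)%:R = \sum_e \sum_(i < x e) \sum_(j < y e) (1 : K).
  rewrite natr_sum; apply: eq_bigr => e _; rewrite !sumr_const !card_ord.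
  by rewrite mulnC mulrnA.
rewrite !cntE; apply/eqP.
pose W := fun e f i j m n => let z := @Fsym K B a b c d e f i j m n in z * z^*.
transitivity (\sum_e \sum_(i < fusN a b e) \sum_(j < fusN e c d)
   \sum_f \sum_(m < fusN b c f) \sum_(n < fusN a f d) W e f i j m n).
  do 3!(apply: eq_bigr => ? _); rewrite /W /= Fsym_unitary_row.
  by rewrite !eqxx.
rewrite sum_tree; under eq_bigr do rewrite sum_tree.
rewrite exchange_big /= [RHS]sum_tree.
apply: eq_bigr => y _.
rewrite -(sum_tree (fun e i j => W e (tag y) i j (tagged y).1 (tagged y).2)).
by rewrite /W /= Fsym_unitary_col !eqxx.
Qed.

End Fusion.

Lemma sum_tree_delta (I : finType) (R : pzSemiRingType) (m n : I -> nat) f0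
    (i0 : 'I_(m f0)) (j0 : 'I_(n f0)) (G : forall f, 'I_(m f) -> 'I_(n f) -> R) :
  \sum_f \sum_(i < m f) \sum_(j < n f)
    [&& f == f0, i == i0 :> nat & j == j0 :> nat]%:R * G f i j = G f0 i0 j0.
Proof.
rewrite (bigD1 f0) //= [X in _ + X]big1 ?addr0 => [|f nf]; last first.
  by apply: big1 => i _; apply: big1 => j _; rewrite (negPf nf) mul0r.
rewrite (bigD1 i0) //= [X in _ + X]big1 ?addr0 => [|i ni]; last first.
  by apply: big1 => j _; rewrite (negPf (ni : (i : nat) != i0)) andbF mul0r.
rewrite (bigD1 j0) //= [X in _ + X]big1 ?addr0 => [|j nj]; last first.
  by rewrite (negPf (nj : (j : nat) != j0)) !andbF mul0r.
by rewrite !eqxx mul1r.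
Qed.

(** * Pentagons rearranged by unitarity *)

Section Pentagons.
Variables (K : numClosedFieldType) (B : ubfc K).
Implicit Types a b c d e f g h k l : B.

(** Orthonormality of the columns of [F^{abc}_g] moves this factor of the pentagon to the other
    side. *)
Lemma pentagon_inv_left a b c d e g h k l
    (s : 'I_(fusN b c h)) (t : 'I_(fusN a h g)) (i3 : 'I_(fusN g d e))
    (j1 : 'I_(fusN c d l)) (j2 : 'I_(fusN b l k)) (j3 : 'I_(fusN a k e)) :
  \sum_f \sum_(i1 < fusN a b f) \sum_(i2 < fusN f c g)
     (Fsym i1 i2 s t)^* * (\sum_n Fsym i2 i3 j1 n * Fsym i1 n j2 j3)
  = \sum_u Fsym t i3 u j3 * Fsym s u j1 j2.
Proof.
pose X h' (s' : 'I_(fusN b c h')) (t' : 'I_(fusN a h' g)) :=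
  \sum_u Fsym t' i3 u j3 * Fsym s' u j1 j2.
rewrite -[RHS](sum_tree_delta s t X).
transitivity (\sum_f \sum_(i1 < fusN a b f) \sum_(i2 < fusN f c g)
   \sum_h' \sum_s' \sum_t' (Fsym i1 i2 s t)^* * Fsym i1 i2 s' t' * @X h' s' t').
  apply: eq_bigr => f _; apply: eq_bigr => i1 _; apply: eq_bigr => i2 _.
  rewrite Fsym_pentagon mulr_sumr; apply: eq_bigr => h' _.
  rewrite mulr_sumr; apply: eq_bigr => s' _.
  rewrite mulr_sumr; apply: eq_bigr => t' _.
  rewrite -mulrA; congr (_ * _); rewrite mulr_sumr; apply: eq_bigr => u _.
  by rewrite mulrA.
rewrite sum_tree; under eq_bigr do rewrite sum_tree.
rewrite exchange_big /= [RHS]sum_tree; apply: eq_bigr => -[h' [s' t']] _ /=.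
rewrite -(sum_tree (fun f i1 i2 =>
  (Fsym i1 i2 s t)^* * Fsym i1 i2 s' t' * @X h' s' t')).
rewrite -(Fsym_unitary_col s' t' s t) mulr_suml; apply: eq_bigr => f _.
rewrite mulr_suml; apply: eq_bigr => i1 _.
by rewrite mulr_suml; apply: eq_bigr => i2 _; rewrite [_^* * _]mulrC.
Qed.

(** Here the rows of [F^{bcd}_k] are used, to move the last factor. *)
Lemma pentagon_inv_right a b c d e f g h k
    (i1 : 'I_(fusN a b f)) (i2 : 'I_(fusN f c g)) (i3 : 'I_(fusN g d e))
    (s : 'I_(fusN b c h)) (u : 'I_(fusN h d k)) (j3 : 'I_(fusN a k e)) :
  \sum_l \sum_(j1 < fusN c d l) \sum_(j2 < fusN b l k)
     (Fsym s u j1 j2)^* * (\sum_n Fsym i2 i3 j1 n * Fsym i1 n j2 j3)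
  = \sum_t Fsym i1 i2 s t * Fsym t i3 u j3.
Proof.
pose X h' (s' : 'I_(fusN b c h')) (u' : 'I_(fusN h' d k)) :=
  \sum_t Fsym i1 i2 s' t * Fsym t i3 u' j3.
rewrite -[RHS](sum_tree_delta s u X).
transitivity (\sum_l \sum_(j1 < fusN c d l) \sum_(j2 < fusN b l k)
   \sum_h' \sum_s' \sum_u' (Fsym s u j1 j2)^* * Fsym s' u' j1 j2 * @X h' s' u').
  apply: eq_bigr => l _; apply: eq_bigr => j1 _; apply: eq_bigr => j2 _.
  rewrite Fsym_pentagon mulr_sumr; apply: eq_bigr => h' _.
  rewrite mulr_sumr; apply: eq_bigr => s' _.
  rewrite exchange_big mulr_sumr; apply: eq_bigr => u' _.
  rewrite -mulrA; congr (_ * _); rewrite mulr_sumr; apply: eq_bigr => t' _.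
  by rewrite mulrC.
rewrite sum_tree; under eq_bigr do rewrite sum_tree.
rewrite exchange_big /= [RHS]sum_tree; apply: eq_bigr => -[h' [s' u']] _ /=.
rewrite -(sum_tree (fun l j1 j2 =>
  (Fsym s u j1 j2)^* * Fsym s' u' j1 j2 * @X h' s' u')).
have := Fsym_unitary_row s' u' s u.
rewrite [_ == h]eq_sym => <-; rewrite mulr_suml; apply: eq_bigr => f' _.
rewrite mulr_suml; apply: eq_bigr => j1 _.
by rewrite mulr_suml; apply: eq_bigr => j2 _; rewrite [_^* * _]mulrC.
Qed.

(** At vacuum total charge the only channels are [e], dual to [c], and [f], dual to [a], so this
    block is all of [F^{abc}_1]. *)
Definition unit_matrix a b c e f (j : 'I_(fusN e c (one B)))
    (n : 'I_(fusN a f (one B))) : 'M[K]_(fusN a b e, fusN b c f) :=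
  \matrix_(i, m) Fsym i j m n.


Lemma unit_matrix_unitary a b c e f (j : 'I_(fusN e c (one B)))
    (n : 'I_(fusN a f (one B))) : unit_matrix b j n \is unitarymx.
Proof.
apply/unitarymxP/matrixP => i i'; rewrite !mxE.
have := Fsym_unitary_row i j i' j; rewrite !eqxx andbT => <-.
rewrite (sum_tree_only (f0 := f)) => [|f' _ n']; last first.
  by rewrite (fusN_one_gt0 n') (fusN_one_gt0 (ord_gt0 n)).
apply: eq_bigr => m _; rewrite (sum_ord_le1 (fusN_one_le1 _ _) n).
by rewrite !mxE.
Qed.

Lemma fusN_rot a b c e f (j : 'I_(fusN e c (one B)))
    (n : 'I_(fusN a f (one B))) : fusN a b e = fusN b c f.
Proof.
have /unitarymxP/mulmx1_min le1 := unit_matrix_unitary b j n.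
apply/eqP; rewrite eqn_leq le1 /=.
suff /mulmx1_min : (unit_matrix b j n)^t* *m unit_matrix b j n = 1%:M by [].
apply/matrixP => m m'; rewrite !mxE.
have := Fsym_unitary_col m n m' n; rewrite !eqxx andbT => /(congr1 Num.conj).
rewrite conjC_nat => <-.
rewrite (sum_tree_only (f0 := e)) => [|e' _ j']; last first.
  by rewrite (fusN_one_gt0C j') (fusN_one_gt0C (ord_gt0 j)).
rewrite rmorph_sum; apply: eq_bigr => i _.
by rewrite (sum_ord_le1 (fusN_one_le1 _ _) j) !mxE rmorphM /= conjCK.
Qed.

End Pentagons.

(** * Bending the legs of a vertex *)

Section Bending.
Variables (K : numClosedFieldType) (B : ubfc K).
Implicit Types a b c p q r s t : B.

(* [bendr] (resp. [bendl]) expresses the bending of the right (resp. left) leg of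
   a vertex of [q] (resp. [p']) through the vacuum vertex [m], in vertex bases. *)
Definition bendr p q q' r (m : 'I_(fusN q q' (one B))) :
    'M[K]_(fusN p q r, fusN r q' p) :=
  \matrix_(i, j) Fsym i j m (unitr_vertex p).

Definition bendl p p' q r (m : 'I_(fusN p p' (one B))) :
    'M[K]_(fusN p' q r, fusN p r q) :=
  \matrix_(i, j) Fsym m (unitl_vertex q) i j.

(** The zigzag scalar of [q], of modulus [1 / d_q]. *)
Definition loop q q' (m : 'I_(fusN q q' (one B)))
    (m' : 'I_(fusN q' q (one B))) : K :=
  Fsym m (unitl_vertex q) m' (unitr_vertex q).

(** Bending a leg there and back makes a zigzag: the pentagon of [s, t, t', t] in which [t t'] and
    [t' t] fuse to the vacuum. *)
Lemma bendr_bendr s t t' r (m : 'I_(fusN t t' (one B)))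
    (m' : 'I_(fusN t' t (one B))) :
  map_mx Num.conj (bendr s r m) *m bendr r s m' = (loop m m')%:M.
Proof.
apply/matrixP => j3 i3; rewrite !mxE.
have := pentagon_inv_left m (unitr_vertex s) i3 m' (unitr_vertex t) j3.
rewrite (sum_ord_le1 (fusN1l_le1 _ _) (unitl_vertex t)) Fsym_unit_m.
rewrite (bigD1 r) //= [X in _ + X]big1 => [|f nf]; last first.
  apply: big1 => i1 _; apply: big1 => i2 _.
  rewrite [X in _ * X]big1 ?mulr0 // => n _.
  by case/eqP: nf; rewrite (fusN1r_gt0 (ord_gt0 n)).
rewrite addr0 (bigD1 j3) //= [X in _ + X]big1 => [|i1 ni]; last first.
  apply: big1 => i2 _; rewrite [X in _ * X]big1 ?mulr0 // => n _.
  by rewrite Fsym_unit_r (negPf (ni : (i1 : nat) != j3)) mulr0.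
rewrite addr0 => E; transitivity ((i3 == j3 :> nat)%:R * loop m m'); last first.
  by rewrite mulr_natl eq_sym.
rewrite /loop -E; apply: eq_bigr => i2 _.
rewrite (sum_ord_le1 (fusN1r_le1 _ _) (unitr_vertex r)) Fsym_unit_r eqxx mulr1.
by rewrite !mxE.
Qed.

(** The mirror image, from the pentagon of [s, s', s, t]. *)
Lemma bendl_bendl s s' t r (m : 'I_(fusN s s' (one B)))
    (m' : 'I_(fusN s' s (one B))) :
  map_mx Num.conj (bendl t r m') *m bendl r t m = (loop m m')%:M.
Proof.
apply/matrixP => i3 j3; rewrite !mxE.
have := pentagon_inv_right m (unitl_vertex s) i3 m' (unitl_vertex t) j3.
rewrite (sum_ord_le1 (fusN1r_le1 _ _) (unitr_vertex s)) Fsym_unit_m.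
rewrite (bigD1 r) //= [X in _ + X]big1 => [|l nl]; last first.
  apply: big1 => j1 _; apply: big1 => j2 _.
  rewrite [X in _ * X]big1 ?mulr0 // => n _.
  by case/eqP: nl; rewrite (fusN1l_gt0 (ord_gt0 n)).
rewrite addr0 (bigD1 i3) //= [X in _ + X]big1 => [|j1 nj]; last first.
  apply: big1 => j2 _; rewrite [X in _ * X]big1 ?mulr0 // => n _.
  by rewrite Fsym_unit_l eq_sym (negPf (nj : (j1 : nat) != i3)) mul0r.
rewrite addr0 => E; transitivity (loop m m' * (i3 == j3 :> nat)%:R); last first.
  by rewrite mulr_natr.
rewrite /loop -E; apply: eq_bigr => j2 _.
rewrite (sum_ord_le1 (fusN1l_le1 _ _) (unitl_vertex r)) Fsym_unit_l eqxx mul1r.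
by rewrite !mxE.
Qed.

(* The two partial traces of a vertex projector on [b (x) c] agree. *)
Lemma bendr_bendl b b' c c' h (m1 : 'I_(fusN b' b (one B)))
    (m2 : 'I_(fusN c c' (one B))) :
  map_mx Num.conj (bendr b h m2) = bendl c h m1 *m unit_matrix h m2 m1.
Proof.
apply/matrixP => s u; rewrite !mxE.
have := pentagon_inv_right m1 (unitl_vertex c) m2 s u m1.
rewrite (bigD1 (one B)) //= [X in _ + X]big1 => [|l nl]; last first.
  apply: big1 => j1 _; apply: big1 => j2 _.
  rewrite [X in _ * X]big1 ?mulr0 // => n _.
  by case/eqP: nl; rewrite (fusN1l_gt0 (ord_gt0 n)).
rewrite addr0 (sum_ord_le1 (fusN_one_le1 _ _) m2).
rewrite (sum_ord_le1 (fusN1r_le1 _ _) (unitr_vertex b)).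
rewrite (sum_ord_le1 (fusN1l_le1 _ _) (unitl_vertex (one B))).
rewrite Fsym_unit_l Fsym_unit_r !eqxx !mulr1 => ->.
by apply: eq_bigr => t _; rewrite !mxE.
Qed.

(** In the pentagon of [r, t', s', r] with [g] and [k] the vacuum, only [h = r'] survives; the
    middle factor is then the zigzag of [r]. *)
Lemma bendr_bendl_unitary r r' s s' t t'
    (w : 'I_(fusN r r' (one B))) (w' : 'I_(fusN r' r (one B)))
    (m : 'I_(fusN s s' (one B))) (m' : 'I_(fusN t' t (one B))) :
  bendr r s m' *m (bendl r t m)^T
  = loop w w' *: (unit_matrix t' m w *m unit_matrix s' w' m').
Proof.
apply/matrixP => i1 j1; rewrite !mxE.
have := Fsym_pentagon i1 m (unitl_vertex r) j1 m' (unitr_vertex r).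
have -> : \sum_n Fsym m (unitl_vertex r) j1 n * Fsym i1 n m' (unitr_vertex r)
  = \sum_j bendr r s m' i1 j * (bendl r t m)^T j j1.
  by apply: eq_bigr => n _; rewrite !mxE mulrC.
move=> ->; rewrite (bigD1 r') //= [X in _ + X]big1 => [|h nh]; last first.
  apply: big1 => i _; apply: big1 => t1 _.
  by case/eqP: nh; rewrite (fusN_one_gt0 (ord_gt0 t1)) (fusN_one_gt0 (ord_gt0 w)).
rewrite addr0 mulr_sumr; apply: eq_bigr => i _.
rewrite (sum_ord_le1 (fusN_one_le1 _ _) w) (sum_ord_le1 (fusN_one_le1 _ _) w').
by rewrite !mxE mulrA [loop _ _ * _]mulrC.
Qed.

End Bending.

(** * Quantum dimensions *)

Lemma map_conjmxK (K : numClosedFieldType) m n (A : 'M[K]_(m, n)) :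
  map_mx Num.conj (map_mx Num.conj A) = A.
Proof. by apply/matrixP => i j; rewrite !mxE conjCK. Qed.

(** Eliminating [A'], [Z] and [Z'] leaves [A V A^t* = c] with [V = W^t* U^t*] unitary and [c] the
    conjugate of [zs zt / zr], as [gram_scalar] requires. *)
Lemma gram_of_bends (K : numClosedFieldType) n0 n1 n2
    (A : 'M[K]_(n0, n1)) (A' : 'M[K]_(n1, n0))
    (Z : 'M[K]_(n0, n2)) (Z' : 'M[K]_(n2, n0))
    (W : 'M[K]_(n2, n1)) (U : 'M[K]_(n1, n2)) (zs zt zr : K) :
    n0 = n1 -> n2 = n1 -> W \is unitarymx -> U \is unitarymx ->
    zs != 0 -> zt != 0 -> zr != 0 ->
    A *m A' = zt%:M -> map_mx Num.conj Z *m Z' = zs%:M -> A = Z *m W ->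
    A' *m Z'^T = zr *: U ->
  A^t* *m A = (`|zs * zt / zr|)%:M.
Proof.
move=> e01 e21; case: n1 / e21 A A' W U e01 => A A' W U e01 Wu Uu zs0 zt0 zr0.
move=> AA' ZZ' AE A'Z'.
rewrite -norm_conjC; apply: (gram_scalar (V := W^t* *m U^t*)) => //.
- by rewrite mul_unitarymx // trmxC_unitary.
- by rewrite conjC_eq0 !mulf_neq0 ?invr_eq0.
have ZE : Z = A *m W^t* by move/unitarymxP: Wu => WW; rewrite AE -mulmxA WW mulmx1.
have h1 : map_mx Num.conj A *m W^T *m Z' = zs%:M.
  by rewrite -ZZ' ZE map_mxM map_conjmxK.
have h2 : Z' *m A'^T = zr *: U^T.
  by rewrite -linearZ -A'Z' /= trmx_mul trmxK.
have h3 : A'^T *m A^T = zt%:M by rewrite -trmx_mul AA' tr_scalar_mx.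
have : map_mx Num.conj A *m W^T *m (zr *: U^T) *m A^T = (zs * zt)%:M.
  by rewrite -h2 !mulmxA h1 -mulmxA h3 -scalar_mxM.
rewrite -scalemxAr -scalemxAl => /(congr1 (fun M => zr^-1 *: M)).
rewrite scalerA mulVf // scale1r scale_scalar_mx mulrC.
move=> /(congr1 (map_mx Num.conj)); rewrite !map_mxM map_scalar_mx /= => <-.
by rewrite map_conjmxK -!map_trmx mulmxA.
Qed.

Section Dimension.
Variables (K : numClosedFieldType) (B : ubfc K).
Implicit Types a b c p q r s t : B.

(** The vacuum channels are variables, so that the formula also applies to the image of a functor,
    where they read [G (one B)]. *)
Lemma qdimE a b e f (i : 'I_(fusN a b e)) (j : 'I_(fusN e a a))
    (m : 'I_(fusN b a f)) (n : 'I_(fusN a f a)) :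
  e = one B -> f = one B -> qdim a = `|Fsym i j m n|^-1.
Proof.
move=> e1 f1; subst e f; have bE := fusN_one_gt0 (ord_gt0 i); subst b.
rewrite /qdim /zigzag (sum_ord_le1 (fusN_one_le1 _ _) i).
rewrite (sum_ord_le1 (fusN1l_le1 _ _) j) (sum_ord_le1 (fusN_one_le1 _ _) m).
by rewrite (sum_ord_le1 (fusN1r_le1 _ _) n).
Qed.

Lemma loop_neq0 q q' (m : 'I_(fusN q q' (one B)))
    (m' : 'I_(fusN q' q (one B))) : loop m m' != 0.
Proof.
have q'E := fusN_one_gt0 (ord_gt0 m); subst q'; exact: Fsym_rigid.
Qed.

Lemma norm_loop q q' (m : 'I_(fusN q q' (one B)))
    (m' : 'I_(fusN q' q (one B))) : `|loop m m'| = (qdim q)^-1.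
Proof. by rewrite (qdimE m (unitl_vertex q) m' (unitr_vertex q)) ?invrK. Qed.

Lemma qdim_gt0 a : 0 < qdim a.
Proof.
rewrite -invr_gt0 -(norm_loop (dual_vertex a) (dual_vertex' a)).
by rewrite normr_gt0 loop_neq0.
Qed.

Lemma qdim_neq0 a : qdim a != 0.
Proof. by rewrite lt0r_neq0 ?qdim_gt0. Qed.

Lemma qdim1 : qdim (one B) = 1.
Proof.
have u := unitl_vertex (one B).
by rewrite (qdimE u u u u) // Fsym_unit_l eqxx normr1 invr1.
Qed.

Lemma fusN_bendr_le p q q' r (m : 'I_(fusN q q' (one B)))
    (m' : 'I_(fusN q' q (one B))) : (fusN p q r <= fusN r q' p)%N.
Proof.
have := bendr_bendr p r m m'.
move=> /(congr1 (fun M => (loop m m')^-1 *: M)).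
rewrite scale_scalar_mx mulVf ?loop_neq0 // scalemxAr.
exact: mulmx1_min.
Qed.

Lemma fusN_bendr p q r : fusN p q r = fusN r (dual q) p.
Proof.
have m := dual_vertex q; have m' := dual_vertex' q.
by apply/eqP; rewrite eqn_leq (fusN_bendr_le p r m m') (fusN_bendr_le r p m' m).
Qed.

(** The conjugated bending has the scalar Gram matrix [d_r / (d_s d_t)]; the sum is its trace. *)
Lemma bendr_gram s t t' r (m : 'I_(fusN t t' (one B))) :
  \sum_i \sum_j (bendr s r m) i j * (bendr s r m i j)^*
  = qdim r / (qdim s * qdim t) *+ fusN s t r.
Proof.
have t'E := fusN_one_gt0 (ord_gt0 m); subst t'.
have m' := dual_vertex' t.
have n := dual_vertex s; have n' := dual_vertex' s.
have w := dual_vertex r; have w' := dual_vertex' r.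
pose A := map_mx Num.conj (bendr s r m).
have E : A^t* *m A = (`|loop n n' * loop m m' / loop w w'|)%:M.
  apply: (gram_of_bends (A' := bendr r s m') (Z := bendl t r n')
    (Z' := bendl r t n) (W := unit_matrix r m n')
    (U := unit_matrix (dual t) n w *m unit_matrix (dual s) w' m')).
  - exact: fusN_bendr.
  - exact: fusN_rot m n'.
  - exact: unit_matrix_unitary.
  - by rewrite mul_unitarymx ?unit_matrix_unitary.
  - exact: loop_neq0.
  - exact: loop_neq0.
  - exact: loop_neq0.
  - exact: bendr_bendr.
  - exact: bendl_bendl.
  - exact: bendr_bendl.
  - exact: bendr_bendl_unitary.
have := congr1 mxtrace E; rewrite mxtrace_scalar.
have -> : qdim r / (qdim s * qdim t) *+ fusN s t r
    = qdim r / (qdim s * qdim t) *+ fusN r (dual t) s by rewrite fusN_bendr.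
rewrite !normrM normfV !norm_loop (invrK (qdim r)) -invfM mulrC => <-.
rewrite exchange_big; apply: eq_bigr => j _; rewrite mxE; apply: eq_bigr => i _.
by rewrite trmxCE !mxE conjCK.
Qed.

(* Column normalization of [F^{p q q'}_p] at the trivial channel. *)
Lemma qdimM p q : qdim p * qdim q = \sum_r (fusN p q r)%:R * qdim r.
Proof.
have m := dual_vertex q; have n := unitr_vertex p.
have := Fsym_unitary_col m n m n; rewrite !eqxx.
have -> : \sum_e \sum_(i < fusN p q e) \sum_(j < fusN e (dual q) p)
    Fsym i j m n * (Fsym i j m n)^*
  = \sum_e (fusN p q e)%:R * qdim e / (qdim p * qdim q).
  apply: eq_bigr => e _; rewrite -mulrA mulr_natl -(bendr_gram p e m).
  apply: eq_bigr => i _; apply: eq_bigr => j _; rewrite !mxE.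
  by rewrite (ord_inj1 (fusN1r_le1 _ _) (unitr_vertex p) n).
rewrite -mulr_suml => /(canRL (mulfVK _)) ->; first by rewrite mul1r.
by rewrite mulf_neq0 ?qdim_neq0.
Qed.

(** For trivial [r] the Gram sum is the single term [d_a^-2], which must equal the inverse of
    [d_a d_(dual a)]. *)
Lemma qdim_dual a : qdim (dual a) = qdim a.
Proof.
have m := dual_vertex a; have m' := dual_vertex' a.
have := bendr_gram a (one B) m'.
rewrite (sum_ord_le1 (fusN_one_le1 _ _) m).
rewrite (sum_ord_le1 (fusN1l_le1 _ _) (unitl_vertex a)) !mxE -normCK.
rewrite -/(loop m m') norm_loop fusN_dual eqxx mulr1n qdim1 div1r exprVn.
by move=> /invr_inj; rewrite expr2 => /(mulfI (qdim_neq0 a)).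
Qed.

Lemma fusN_bendl p q r : fusN p q r = fusN (dual p) r q.
Proof. by rewrite fusNC fusN_bendr fusNC. Qed.

End Dimension.

(** * Hexagons and double braids *)

Lemma tree_eqE (I : finType) (m n : I -> nat)
    (x y : {f : I & ('I_(m f) * 'I_(n f))%type}) :
  (x == y) = [&& tag x == tag y, (tagged x).1 == (tagged y).1 :> nat
                & (tagged x).2 == (tagged y).2 :> nat].
Proof.
case: x y => [f [i j]] [f' [i' j']]; rewrite -tag_eqE /tag_eq /=.
case: eqP => //= e; case: f' / e i' j' => i' j'.
by rewrite tagged_asE xpair_eqE.
Qed.

Lemma dot_unitary (K : numClosedFieldType) (T1 T2 T3 : finType)
    (P Q : T1 -> T2 -> K) (U : T2 -> T3 -> K) :
    (forall y y', \sum_w U y w * (U y' w)^* = (y == y')%:R) ->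
  \sum_x \sum_w (\sum_y P x y * U y w) * (\sum_y Q x y * U y w)^*
  = \sum_x \sum_y P x y * (Q x y)^*.
Proof.
move=> Uu; apply: eq_bigr => x _.
transitivity (\sum_w \sum_y \sum_y'
    P x y * (Q x y')^* * (U y w * (U y' w)^*)).
  apply: eq_bigr => w _; rewrite mulr_suml; apply: eq_bigr => y _.
  rewrite rmorph_sum mulr_sumr; apply: eq_bigr => y' _.
  by rewrite rmorphM mulrACA.
rewrite exchange_big; apply: eq_bigr => y _; rewrite exchange_big /=.
rewrite (bigD1 y) //= [X in _ + X]big1 ?addr0 => [|y' ny].
  by rewrite -mulr_sumr Uu eqxx mulr1.
by rewrite -mulr_sumr Uu eq_sym (negPf ny) mulr0.
Qed.

Section DoubleBraid.
Variables (K : numClosedFieldType) (B : ubfc K).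
Implicit Types a b c d e f g h : B.

Definition RsymV : Rdata K (@fusN K B) := fun a b c => (Rsym b a c)^t*.

Section Exchange.
Variables a b c d : B.

(** The left side of the hexagon, as a matrix in [i1] and [j1]. *)
Definition hexmx (X : Rdata K (@fusN K B)) e f (i2 : 'I_(fusN e c d))
    (j2 : 'I_(fusN b f d)) : 'M[K]_(fusN a b e, fusN c a f) :=
  X a b e *m (\matrix_(s, t) Fsym s i2 t j2) *m X a c f.

(* Pairs the hexagon of the braiding with that of its inverse: unitarity of [F]
   turns either side of the hexagons into traces of double braids. *)
Definition hexdot : K :=
  \sum_e \sum_(i1 < fusN a b e) \sum_(i2 < fusN e c d)
  \sum_f \sum_(j1 < fusN c a f) \sum_(j2 < fusN b f d)
    hexmx (@Rsym K B) i2 j2 i1 j1 * (hexmx RsymV i2 j2 i1 j1)^*.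

(** The pairing gives traces of [R_ab F R_ac R_ca F^t* R_ba]: the middle double braid is scalar, and
    [F F^t*] sums to the identity. *)
Lemma hexdot_left gamma : (forall f, double_braid a c f = gamma%:M) ->
  hexdot = gamma * \sum_e \tr (double_braid a b e) *+ fusN e c d.
Proof.
move=> acE; rewrite mulr_sumr; apply: eq_bigr => e _.
rewrite exchange_big /=.
transitivity (\sum_(i2 < fusN e c d) gamma * \tr (double_braid a b e)).
  2: by rewrite sumr_const card_ord -mulrnAr.
apply: eq_bigr => i2 _.
pose Fm f (j2 : 'I_(fusN b f d)) : 'M[K]_(fusN b a e, fusN a c f) :=
  \matrix_(s, t) Fsym s i2 t j2.
have Fm1 : \sum_f \sum_j2 @Fm f j2 *m (@Fm f j2)^t* = 1%:M.
  apply/matrixP => s s'; rewrite summxE mxE.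
  have := Fsym_unitary_row s i2 s' i2; rewrite !eqxx andbT => <-.
  apply: eq_bigr => f _; rewrite exchange_big summxE; apply: eq_bigr => j2 _.
  by rewrite mxE; apply: eq_bigr => t _; rewrite !mxE.
transitivity (\sum_f \sum_(j2 < fusN b f d)
  \tr (hexmx (@Rsym K B) i2 j2 *m (hexmx RsymV i2 j2)^t*)).
  rewrite exchange_big; apply: eq_bigr => f _ /=.
  under eq_bigr do rewrite exchange_big /=.
  rewrite exchange_big; apply: eq_bigr => j2 _; apply: eq_bigr => i1 _.
  by rewrite mxE; apply: eq_bigr => j1 _; rewrite trmxCE.

transitivity (\sum_f \sum_j2 gamma *
    \tr (Rsym b a e *m Rsym a b e *m (@Fm f j2 *m (@Fm f j2)^t*))).
  apply: eq_bigr => f _; apply: eq_bigr => j2 _.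
  rewrite /hexmx !trmxC_mul !trmxCK -/(Fm f j2) !mulmxA.
  rewrite -[_ *m Rsym c a f]mulmxA (acE f : Rsym a c f *m _ = _).
  rewrite mul_mx_scalar -!scalemxAl mxtraceZ mxtrace_mulC.
  by rewrite !mulmxA.
under eq_bigr do rewrite -mulr_sumr -raddf_sum -mulmx_sumr.
rewrite -mulr_sumr -raddf_sum -mulmx_sumr Fm1 mulmx1; congr (_ * _).
exact: mxtrace_mulC.
Qed.

(** Each right side is [P U] with [U] the unitary [F^{bca}_d]. Two uses of [dot_unitary] remove [U]
    and then [F^{abc}_d], leaving [R_ag R_ga]. *)
Lemma hexdot_right :
  hexdot = \sum_g \tr (double_braid a g d) *+ fusN b c g.
Proof.
pose P (X : Rdata K (@fusN K B))
    (x : {e : B & ('I_(fusN a b e) * 'I_(fusN e c d))%type})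
    (y : {g : B & ('I_(fusN b c g) * 'I_(fusN g a d))%type}) :=
  \sum_t Fsym (tagged x).1 (tagged x).2 (tagged y).1 t
     * X a (tag y) d t (tagged y).2.
pose U (y : {g : B & ('I_(fusN b c g) * 'I_(fusN g a d))%type})
    (w : {f : B & ('I_(fusN c a f) * 'I_(fusN b f d))%type}) :=
  Fsym (tagged y).1 (tagged y).2 (tagged w).1 (tagged w).2.
have hexE (X : Rdata K (@fusN K B)) x w : hexagon (@Fsym K B) X ->
    hexmx X (tagged x).2 (tagged w).2 (tagged x).1 (tagged w).1
    = \sum_y P X x y * U y w.
  case: x w => e [i1 i2] [f [j1 j2]] hX /=; rewrite /hexmx.
  transitivity (\sum_(s < fusN b a e) \sum_(t < fusN a c f)
     X a b e i1 s * Fsym s i2 t j2 * X a c f t j1).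
    rewrite exchange_big mxE; apply: eq_bigr => t _.
    by rewrite mxE mulr_suml; apply: eq_bigr => s _; rewrite mxE.
  rewrite hX /P /U /=.
  rewrite -(sum_tree (fun g s u => (\sum_t Fsym i1 i2 s t * X a g d t u)
     * Fsym s u j1 j2)).
  apply: eq_bigr => g _; apply: eq_bigr => s _.
  by rewrite exchange_big; apply: eq_bigr => u _; rewrite mulr_suml.
transitivity (\sum_x \sum_w (\sum_y P (@Rsym K B) x y * U y w)
     * (\sum_y P RsymV x y * U y w)^*).
  rewrite /hexdot; under eq_bigr do under eq_bigr do under eq_bigr do rewrite sum_tree.
  rewrite sum_tree; apply: eq_bigr => x _; apply: eq_bigr => w _.
  rewrite (hexE _ x w (@Rsym_hexagon K B)).
  by rewrite (hexE _ x w (@Rsym_hexagonV K B)).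
rewrite dot_unitary => [|y y']; last first.
  rewrite tree_eqE -(Fsym_unitary_row _ _ (tagged y').1 (tagged y').2).
  by rewrite [RHS]sum_tree.
rewrite exchange_big /= -(sum_tree (fun g s u => \sum_x
  P (@Rsym K B) x (Tagged _ (s, u)) * (P RsymV x (Tagged _ (s, u)))^*)).
apply: eq_bigr => g _; rewrite -[X in _ *+ X]card_ord -sumr_const.
apply: eq_bigr => s _.
pose V (t : 'I_(fusN a g d)) (x : {e : B & ('I_(fusN a b e) * 'I_(fusN e c d))%type}) :=
  Fsym (tagged x).1 (tagged x).2 s t.
transitivity (\sum_u \sum_x (\sum_t Rsym a g d t u * V t x)
   * (\sum_t RsymV a g d t u * V t x)^*).
  apply: eq_bigr => u _; apply: eq_bigr => x _; congr (_ * _^*);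
  by apply: eq_bigr => t _; rewrite mulrC.
rewrite (dot_unitary (fun u t => Rsym a g d t u) (fun u t => RsymV a g d t u)).
  rewrite exchange_big; apply: eq_bigr => t _; rewrite mxE.
  by apply: eq_bigr => u _; rewrite trmxCE conjCK.
move=> t t'; have := Fsym_unitary_col s t s t'; rewrite !eqxx /= => <-.
by rewrite [RHS]sum_tree.
Qed.

End Exchange.

(** Trace form of the rule that encircling [b] and [c] together is encircling each in turn. *)
Lemma double_braid_trace a b c d gamma :
    (forall f, double_braid a c f = gamma%:M) ->
  \sum_g \tr (double_braid a g d) *+ fusN b c g
  = gamma * \sum_e \tr (double_braid a b e) *+ fusN e c d.
Proof. by move=> acE; rewrite -hexdot_right; apply: hexdot_left. Qed.

End DoubleBraid.

(** * Scalar double braids *)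

Section DoubleBraidScalar.
Variables (K : numClosedFieldType) (B : ubfc K).
Implicit Types a b c d e f g x y : B.

Lemma mxtrace_double_braidC a b c :
  \tr (double_braid a b c) = \tr (double_braid b a c).
Proof. exact: mxtrace_mulC. Qed.

Lemma double_braid_scalarC a b c gamma :
  double_braid a b c = gamma%:M -> double_braid b a c = gamma%:M.
Proof.
rewrite /double_braid => E; have /unitarymxP RR := Rsym_unitary b a c.
rewrite -[LHS]mulmx1 -RR !mulmxA -[X in X *m _]mulmxA E.
by rewrite mul_mx_scalar -scalemxAl RR scalemx1.
Qed.

(** Each double braid is empty or a 1 by 1 matrix, whose entry is then the whole sum. *)
Lemma double_braid_scalar a b :
    (\sum_c fusN a b c <= 1)%N ->
  forall c, double_braid a b c = (\sum_c' \tr (double_braid a b c'))%:M.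
Proof.
move=> le1 c; apply/matrixP => i j; move: le1; rewrite (bigD1 c) //= => le1.
have c_le1 : (fusN a b c <= 1)%N := leq_trans (leq_addr _ _) le1.
have other c' : c' != c -> fusN a b c' = 0%N.
  move=> nc; move: le1 (ord_gt0 i); rewrite (bigD1 c') //=.
  by case: (fusN a b c) => // n; case: (fusN a b c') => // n'; rewrite addnS.
rewrite (ord_inj1 c_le1 j i) [RHS]mxE eqxx (bigD1 c) //= big1 => [|c' nc]; last first.
  by apply: big1 => k _; exfalso; move: (ord_gt0 k); rewrite other.
by rewrite addr0 /mxtrace (sum_ord_le1 c_le1 i).
Qed.

(** Taking [b] and [c] to be the unit gives [mu = mu ^+ 2]; unitarity excludes [mu = 0]. *)
Lemma double_braid_one x : \tr (double_braid x (one B) x) = 1.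
Proof.
pose mu := \sum_c \tr (double_braid x (one B) c).
have muE c : double_braid x (one B) c = mu%:M.
  apply: double_braid_scalar; rewrite (bigD1 x) //= big1 => [|c' nc].
    by rewrite fusN1r eqxx.
  by rewrite fusN1r (negPf nc).
have mu0 : mu != 0.
  apply/eqP => mu0; have := muE x; rewrite mu0 /double_braid => E.
  have /unitarymxP RR := Rsym_unitary x (one B) x.
  have /unitarymxP RR' := Rsym_unitary (one B) x x.
  have : 1%:M = 0 :> 'M[K]_(fusN x (one B) x).
    rewrite -RR -[X in X *m _]mulmx1 -RR' !mulmxA E.
    by rewrite -mulmxA mul_scalar_mx scale0r.
  move=> /matrixP /(_ (unitr_vertex x) (unitr_vertex x)) /eqP.
  by rewrite !mxE eqxx oner_eq0.
have tr_mu : \tr (double_braid x (one B) x) = mu.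
  by rewrite muE mxtrace_scalar fusN1r eqxx.
have := double_braid_trace (one B) x muE.
rewrite (bigD1 (one B)) //= big1 => [|g ng]; last by rewrite fusN1l (negPf ng).
rewrite addr0 fusN1l eqxx mulr1n (bigD1 x) //= big1 => [|e ne]; last first.
  by rewrite (fusN1r e x) eq_sym (negPf ne).
rewrite addr0 tr_mu fusN1r eqxx mulr1n => /eqP.
by rewrite -{1}[mu]mulr1 eq_sym (inj_eq (mulfI mu0)) => /eqP.
Qed.

End DoubleBraidScalar.

(** * The grading by a fermion *)

Section Fermion.
Variables (K : numClosedFieldType) (B : ubfc K) (psi : B).
Hypothesis psi2 : fuses_to psi psi (one B).
Implicit Types a b c d e f g x y : B.

Lemma fusN_psi_psi c : fusN psi psi c = (c == one B).
Proof. by have /forallP/(_ c)/eqP := psi2. Qed.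

Lemma dual_psi : dual psi = psi.
Proof. by apply/esym/fusN_one_gt0; rewrite fusN_psi_psi eqxx. Qed.

Lemma fusN_psiC x c : fusN x psi c = fusN c psi x.
Proof. by rewrite fusN_bendr dual_psi. Qed.

(** The default [x] is never taken: a channel exists by the count in [fusN_psi]. *)
Definition mulpsi x : B := odflt x [pick c | (0 < fusN x psi c)%N].

(** As [psi] is its own inverse, associativity makes the squared multiplicities of [x] times [psi]
    sum to 1. *)
Lemma fusN_psi x c : fusN x psi c = (c == mulpsi x).
Proof.
have : (\sum_e fusN x psi e * fusN x psi e = 1)%N.
  under eq_bigr => e _ do rewrite {2}(fusN_psiC x e).
  rewrite fusNA (bigD1 (one B)) //= big1 => [|f nf].
    by rewrite fusN_psi_psi fusN1r !eqxx.
  by rewrite fusN_psi_psi (negPf nf).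
rewrite /mulpsi; case: pickP => /= [e e_gt0|none].
  rewrite (bigD1 e) //= => sum1; have [->|ne] := eqVneq c e.
    by move: sum1 e_gt0; case: (fusN x psi e) => [|[|n]].
  move: sum1 e_gt0; rewrite (bigD1 c) //=.
  case: (fusN x psi e) => // n; case: (fusN x psi c) => // n'.
  by rewrite !mulSn !addSn !addnS.
by rewrite big1 // => e _; have := none e; case: (fusN x psi e).
Qed.

Lemma fusN_psil x c : fusN psi x c = (c == mulpsi x).
Proof. by rewrite fusNC fusN_psi. Qed.

Lemma mulpsiK : involutive mulpsi.
Proof.
by move=> x; have := fusN_psiC x (mulpsi x); rewrite !fusN_psi eqxx; case: eqP.
Qed.

Lemma mulpsi1 : mulpsi (one B) = psi.
Proof. by have := fusN_psi (one B) psi; rewrite fusN1l eqxx; case: eqP. Qed.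

Lemma fuses_to_mulpsi x : fuses_to x psi (mulpsi x).
Proof. by apply/forallP => c; rewrite fusN_psi. Qed.

Lemma dual_mulpsi x : dual (mulpsi x) = mulpsi (dual x).
Proof.
rewrite -[in LHS](dualK x); set y := dual x.
have : fusN y psi (mulpsi y) = 1%N by rewrite fusN_psi eqxx.
rewrite fusN_bendl fusN_bendr fusN_psil.
case: eqP => // E _; apply: (can_inj (@dualK _ B)); rewrite dualK.
by rewrite E mulpsiK.
Qed.

Lemma qdim_psi : qdim psi = 1.
Proof.
have := qdimM psi psi; rewrite (bigD1 (one B)) //= big1 => [|c nc].
  rewrite fusN_psi_psi eqxx qdim1 addr0 mulr1 => /eqP.
  by rewrite -expr2 sqrp_eq1 ?ltW ?qdim_gt0 // => /eqP.
by rewrite fusN_psi_psi (negPf nc) mul0r.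
Qed.

Lemma qdim_mulpsi x : qdim (mulpsi x) = qdim x.
Proof.
have := qdimM x psi; rewrite qdim_psi mulr1 => ->.
rewrite (bigD1 (mulpsi x)) //= big1 => [|c nc].
  by rewrite fusN_psi eqxx mul1r addr0.
by rewrite fusN_psi (negPf nc) mul0r.
Qed.

(** Only the channel [mulpsi x] contributes to the sum. *)
Definition eps x : K := \sum_c \tr (double_braid x psi c).

Lemma double_braid_psi x c : double_braid x psi c = (eps x)%:M.
Proof.
apply: double_braid_scalar; rewrite (bigD1 (mulpsi x)) //= big1 => [|c' nc].
  by rewrite fusN_psi eqxx.
by rewrite fusN_psi (negPf nc).
Qed.

Lemma double_braid_psil x c : double_braid psi x c = (eps x)%:M.
Proof. exact/double_braid_scalarC/double_braid_psi. Qed.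

(** Encircling [psi] twice is encircling the unit. *)
Lemma eps_sqr x : eps x ^+ 2 = 1.
Proof.
have := double_braid_trace psi x (double_braid_psi x).
rewrite (bigD1 (one B)) //= big1 => [|g ng]; last first.
  by rewrite fusN_psi_psi (negPf ng).
rewrite fusN_psi_psi eqxx mulr1n addr0 double_braid_one => ->.
rewrite expr2; congr (_ * _); apply: eq_bigr => e _.
rewrite double_braid_psi mxtrace_scalar -mulrnA.
by rewrite -[fusN e psi x]fusN_psiC fusN_psi; case: eqP.
Qed.

Lemma epsP x : eps x = 1 \/ eps x = -1.
Proof. by have /eqP := eps_sqr x; rewrite sqrf_eq1 => /orP[]/eqP; auto. Qed.

Lemma fusN_mulpsi b c g : fusN (mulpsi b) c (mulpsi g) = fusN b c g.
Proof.
have := fusNA psi b c (mulpsi g).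
rewrite (bigD1 (mulpsi b)) //= big1 => [|e ne]; last first.
  by rewrite fusN_psil (negPf ne).
rewrite (bigD1 g) //= big1 => [|f nf]; last first.
  by rewrite fusN_psil (inj_eq (inv_inj mulpsiK)) eq_sym (negPf nf) muln0.
by rewrite !fusN_psil !eqxx !addn0 mul1n muln1.
Qed.

(** At total charge [mulpsi g] only the channels [g] and [mulpsi b] survive, with the same positive
    multiplicity, which cancels. *)
Lemma epsM b c g : (0 < fusN b c g)%N -> eps g = eps b * eps c.
Proof.
move=> N_gt0; have := double_braid_trace b (mulpsi g) (double_braid_psil c).
rewrite (bigD1 g) //= big1 => [|g' ng]; last first.
  rewrite double_braid_psil mxtrace_scalar fusN_psil.
  by rewrite (inj_eq (inv_inj mulpsiK)) eq_sym (negPf ng) mul0rn.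
rewrite addr0 (bigD1 (mulpsi b)) //= big1 => [|e ne]; last first.
  by rewrite double_braid_psil mxtrace_scalar fusN_psil (negPf ne) mul0rn.
rewrite addr0 !double_braid_psil !mxtrace_scalar !fusN_psil !eqxx fusN_mulpsi.
rewrite !mulr1n -[eps g *+ _]mulr_natr -[eps b *+ _]mulr_natr mulrA [eps c * _]mulrC.
by move=> /mulIf; apply; rewrite pnatr_eq0 -lt0n.
Qed.

Lemma eps_neq0 x : eps x != 0.
Proof.
apply/eqP => E; have := eps_sqr x.
by rewrite E expr0n => /esym/eqP; rewrite oner_eq0.
Qed.

Lemma eps1 : eps (one B) = 1.
Proof.
have := @epsM (one B) (one B) (one B); rewrite fusN1l eqxx => /(_ isT) /eqP.
by rewrite -{1}[eps _]mulr1 (inj_eq (mulfI (eps_neq0 _))) eq_sym => /eqP.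
Qed.

Lemma eps_dual x : eps (dual x) = eps x.
Proof.
have := epsM (ord_gt0 (dual_vertex x)); rewrite eps1 -(eps_sqr x) expr2.
by move=> /(mulfI (eps_neq0 x)).
Qed.

(** The Hopf link without normalization and without the dual in [Smatrix], hence symmetric. *)
Definition hopf a b : K := \sum_c qdim c * \tr (double_braid a b c).

Lemma hopfC a b : hopf a b = hopf b a.
Proof. by apply: eq_bigr => c _; rewrite mxtrace_double_braidC. Qed.

Lemma hopf_mulpsi a b : hopf b (mulpsi a) = eps b * hopf b a.
Proof.
rewrite /hopf mulr_sumr (reindex_inj (inv_inj mulpsiK)) /=.
apply: eq_bigr => d _; rewrite qdim_mulpsi mulrCA; congr (_ * _).
have := double_braid_trace a (mulpsi d) (double_braid_psi b).
rewrite (bigD1 (mulpsi a)) //= big1 => [|g ng]; last first.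
  by rewrite fusN_psi (negPf ng).
rewrite (bigD1 d) //= big1 => [|e ne]; last first.
  by rewrite fusN_psi (inj_eq (inv_inj mulpsiK)) eq_sym (negPf ne).
by rewrite !fusN_psi !eqxx !addr0.
Qed.

Lemma Smatrix_mulpsir a b : Smatrix a (mulpsi b) = eps a * Smatrix a b.
Proof. by rewrite /Smatrix -!/(hopf _ _) hopf_mulpsi eps_dual mulrCA. Qed.

Lemma Smatrix_mulpsil a b : Smatrix (mulpsi a) b = eps b * Smatrix a b.
Proof.
rewrite /Smatrix -!/(hopf _ _) dual_mulpsi hopfC hopf_mulpsi mulrCA.
by rewrite [hopf b _]hopfC.
Qed.

Lemma vortexE x : vortex psi x = (eps x == -1).
Proof.
apply/forallP/eqP => [/(_ (mulpsi x))/eqP|E c]; last first.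
  by rewrite double_braid_psi E.
rewrite double_braid_psi => /(congr1 mxtrace).
by rewrite !mxtrace_scalar fusN_psi eqxx.
Qed.

(** * Consequences of modularity *)

Hypotheses (psi_neq1 : psi != one B) (modB : modular B).

Lemma Smatrix_inj (v : B -> K) :
  (forall a, \sum_b Smatrix a b * v b = 0) -> forall b, v b = 0.
Proof.
move=> Sv0 b; pose w : 'cV[K]_#|B| := \col_i v (enum_val i).
have : w = 0; last first.
  by move=> /colP/(_ (enum_rank b)); rewrite !mxE enum_rankK.
rewrite -[w](mulKmx modB); rewrite [X in _ *m X](_ : _ = 0) ?mulmx0 //.
apply/colP => i; rewrite !mxE -[RHS](Sv0 (enum_val i)).
rewrite (reindex (@enum_rank B)) /=; last first.
  by apply: onW_bij; exact: enum_rank_bij.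
by apply: eq_bigr => c _; rewrite !mxE !enum_rankK.
Qed.

Lemma sum_mul_pred1 (I : finType) (R : pzSemiRingType) (G : I -> R) i0 :
  \sum_i G i * (i == i0)%:R = G i0.
Proof.
rewrite (bigD1 i0) //= big1 => [|i /negPf->]; last by rewrite mulr0.
by rewrite eqxx mulr1 addr0.
Qed.

(** Otherwise [psi] and the unit would have equal columns in the invertible S-matrix. *)
Lemma exists_vortex : exists v, eps v = -1.
Proof.
have [/existsP[v /eqP Ev]|no] := boolP [exists v, eps v == -1]; first by exists v.
have all1 a : eps a = 1.
  by case: (epsP a) => // Ea; case/existsP: no; exists a; rewrite Ea.
pose w b : K := (b == psi)%:R - (b == one B)%:R.
have /Smatrix_inj/(_ psi)/eqP : forall a, \sum_b Smatrix a b * w b = 0.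
  move=> a; under eq_bigr do rewrite mulrBr.
  by rewrite sumrB !sum_mul_pred1 -mulpsi1 Smatrix_mulpsir all1 mul1r subrr.
by rewrite /w eqxx (negPf psi_neq1) subr0 oner_eq0.
Qed.

(** Fusion with a vortex [v] reverses the grade, so expanding [d_v d_c] and summing back over [c]
    gives [d_v Q = - d_v Q]. *)
Lemma sum_eps_qdim : \sum_a eps a * qdim a ^+ 2 = 0.
Proof.
have [v Ev] := exists_vortex; set Q := (X in X = 0).
have : qdim v * Q = - (qdim v * Q).
  rewrite /Q mulr_sumr.
  transitivity (\sum_c \sum_b - (eps b * qdim b * ((fusN b (dual v) c)%:R * qdim c))).
    apply: eq_bigr => c _.
    have -> : qdim v * (eps c * qdim c ^+ 2) = eps c * qdim c * (qdim v * qdim c).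
      by ring.
    rewrite qdimM mulr_sumr; apply: eq_bigr => b _.
    have -> : fusN b (dual v) c = fusN v c b by rewrite [RHS]fusNC [RHS]fusN_bendr.
    have [->|N_gt0] := posnP (fusN v c b); first by rewrite !(mul0r, mulr0) oppr0.
    by rewrite (epsM N_gt0) Ev; ring.
  rewrite exchange_big /= -sumrN; apply: eq_bigr => b _.
  by rewrite sumrN -mulr_sumr -qdimM qdim_dual; ring.
move=> /eqP; rewrite -addr_eq0 -mulr2n -mulr_natr !mulf_eq0 pnatr_eq0.
by rewrite (negPf (qdim_neq0 v)) orbF => /eqP.
Qed.

Lemma total_dim2E : total_dim2 B = 2 * \sum_(a | eps a == 1) qdim a ^+ 2.
Proof.
have := sum_eps_qdim; rewrite (bigID (fun a => eps a == 1)) /=.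
have -> : \sum_(a | eps a != 1) eps a * qdim a ^+ 2
  = - \sum_(a | eps a != 1) qdim a ^+ 2.
  rewrite -sumrN; apply: eq_bigr => a; case: (epsP a) => ->; first by rewrite eqxx.
  by rewrite mulN1r.
under eq_bigr => a /eqP Ea do rewrite Ea mul1r.
move=> /eqP; rewrite subr_eq0 => /eqP E.
by rewrite /total_dim2 (bigID (fun a => eps a == 1)) /= -E; ring.
Qed.

Lemma even_Smatrix_sep x y :
  (forall a, eps a = 1 -> Smatrix a y = Smatrix a x) -> y = x \/ y = mulpsi x.
Proof.
(* Rows with [eps a = -1] cancel within each pair; rows with [eps a = 1] double entries that agree
   by [Exy]. *)
move=> Exy; pose w b : K := (b == x)%:R + (b == mulpsi x)%:R
  - ((b == y)%:R + (b == mulpsi y)%:R).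
have /Smatrix_inj/(_ y) : forall a, \sum_b Smatrix a b * w b = 0.
  move=> a; under eq_bigr do rewrite mulrBr !mulrDr.
  rewrite sumrB !big_split /= !sum_mul_pred1 !Smatrix_mulpsir.
  by case: (epsP a) => [/[dup]/Exy-> ->|->]; rewrite ?subrr // !mulN1r !subrr.
(* The negative part of [w] at [y] is at least 1, so [y] must meet the positive part. *)
rewrite /w eqxx => /eqP; rewrite subr_eq0 -!natrD eqr_nat.
case: (eqVneq y x) => [|_]; first by left.
by case: (eqVneq y (mulpsi x)) => [|_]; first by right.
Qed.

End Fermion.

(** * Functors and minimal modular extensions *)

Section Embeddings.
Variables (K : numClosedFieldType) (B B' : ubfc K) (G : functor_data B B').
Hypothesis embG : braided_embedding G.
Implicit Types a b c : B.

Lemma emb_fusN a b c : fusN (G a) (G b) (G c) = fusN a b c.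
Proof.
have [VV' V'V] := vmap_unitary embG a b c.
by apply/eqP; rewrite eqn_leq (mulmx1_min VV') (mulmx1_min V'V).
Qed.

Lemma emb_dual a : G (dual a) = dual (G a).
Proof.
by apply: fusN_one_gt0; rewrite -(obj_one embG) emb_fusN fusN_dual eqxx.
Qed.

Lemma norm_vmap a b c (i : 'I_(fusN a b c)) (j : 'I_(fusN (G a) (G b) (G c))) :
  (fusN a b c <= 1)%N -> `|vmap G a b c i j| = 1.
Proof.
move=> le1; have [/matrixP/(_ i i)] := vmap_unitary embG a b c.
rewrite !mxE eqxx (sum_ord_le1 _ j) ?emb_fusN // trmxCE -normCK => /eqP.
by rewrite sqrp_eq1 // => /eqP.
Qed.

(** All four vertex spaces are one-dimensional, so the functor changes the zigzag only by phases and
    possibly by conjugation. *)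
Lemma emb_qdim a : qdim (G a) = qdim a.
Proof.
have i := dual_vertex a; have j := unitl_vertex a.
have m := dual_vertex' a; have n := unitr_vertex a.
pose i' := cast_ord (esym (emb_fusN _ _ _)) i.
pose j' := cast_ord (esym (emb_fusN _ _ _)) j.
pose m' := cast_ord (esym (emb_fusN _ _ _)) m.
pose n' := cast_ord (esym (emb_fusN _ _ _)) n.
rewrite (qdimE i j m n) // (qdimE i' j' m' n') ?(obj_one embG) //.
have := vmap_Fsym embG i j m' n'.
rewrite (sum_ord_le1 _ i') ?emb_fusN ?fusN_one_le1 //.
rewrite (sum_ord_le1 _ j') ?emb_fusN ?fusN1l_le1 //.
rewrite (sum_ord_le1 (fusN_one_le1 _ _) m) (sum_ord_le1 (fusN1r_le1 _ _) n).
move=> /(congr1 Num.norm); rewrite !normrM.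
rewrite !norm_vmap ?fusN_one_le1 ?fusN1l_le1 ?fusN1r_le1 // !mul1r !mulr1 => ->.
by rewrite /conj_if; case: (anti G); rewrite ?norm_conjC.
Qed.

Hypothesis linG : anti G = false.

Lemma emb_double_braid a b c :
  double_braid (G a) (G b) (G c)
  = (vmap G a b c)^t* *m double_braid a b c *m vmap G a b c.
Proof.
have R x y : vmap G x y c *m Rsym (G x) (G y) (G c) = Rsym x y c *m vmap G y x c.
  rewrite (vmap_Rsym embG) linG; congr (_ *m _).
  by apply/matrixP => i j; rewrite mxE.
have [_ V'V] := vmap_unitary embG a b c.
rewrite -[LHS]mul1mx -V'V -!mulmxA; congr (_ *m _).
by rewrite /double_braid mulmxA R -mulmxA R mulmxA.
Qed.

Lemma emb_double_braid_tr a b c :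
  \tr (double_braid (G a) (G b) (G c)) = \tr (double_braid a b c).
Proof.
have [VV' _] := vmap_unitary embG a b c.
by rewrite emb_double_braid -mulmxA mxtrace_mulC -mulmxA VV' mulmx1.
Qed.

End Embeddings.

Lemma aut_Smatrix (K : numClosedFieldType) (B : ubfc K) (G : functor_data B B)
    (a b : B) :
    braided_embedding G -> anti G = false ->
  Smatrix (G a) (G b) = Smatrix a b.
Proof.
move=> embG linG; rewrite /Smatrix; congr (_ * _).
rewrite (reindex_inj (obj_inj embG)); apply: eq_bigr => c _.
by rewrite (emb_qdim embG) -(emb_dual embG) (emb_double_braid_tr embG).
Qed.

(** * The even part of a minimal modular extension *)

Section MinimalExtension.
Variables (K : numClosedFieldType) (C Cv : ubfc K) (psi : C).
Variable iota : functor_data C Cv.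
Hypothesis hext : minimal_modular_extension psi iota.

(** By [obj_fus], every channel of [iota psi] with itself comes from [C]. *)
Lemma ext_fuses_to : fuses_to (iota psi) (iota psi) (one Cv).
Proof.
have embi := ext_embedding hext.
have [_ _ _ /forallP psi2] := ext_super_modular hext.
apply/forallP => c'.
have [N0|] := eqVneq (fusN (iota psi) (iota psi) c') 0%N; last first.
  move=> /(obj_fus embi)[c ->]; rewrite emb_fusN // (eqP (psi2 c)).
  by rewrite -(obj_one embi) (inj_eq (obj_inj embi)).
have [c'1|//] := eqVneq c' (one Cv); last by rewrite N0.
by move: N0; rewrite c'1 -(obj_one embi) emb_fusN // (eqP (psi2 _)) eqxx.
Qed.

Lemma ext_psi_neq1 : iota psi != one Cv.
Proof.
have embi := ext_embedding hext; have [psi1 _ _ _] := ext_super_modular hext.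
by rewrite -(obj_one embi) (inj_eq (obj_inj embi)).
Qed.

Lemma ext_eps (a : C) : eps (iota psi) (iota a) = 1.
Proof.
have embi := ext_embedding hext; have [_ tr_psi _ _] := ext_super_modular hext.
have fuse := ext_fuses_to.
have [|c cE] := @obj_fus _ _ _ _ embi a psi (mulpsi (iota psi) (iota a)).
  by rewrite fusN_psi // eqxx.
have Mc : double_braid a psi c = 1%:M.
  by apply: double_braid_scalarC; apply: (proj2 (tr_psi psi)); right.
have := emb_double_braid_tr embi (ext_linear hext) a psi c.
rewrite Mc -cE double_braid_psi // !mxtrace_scalar cE (emb_fusN embi).
by rewrite -(emb_fusN embi) -cE fusN_psi // eqxx.
Qed.

(** Even objects and the image of [C] have equal total dimension; an even object outside the image
    would add a positive square. *)
Lemma ext_even_image (x : Cv) : eps (iota psi) x = 1 -> exists a, x = iota a.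
Proof.
have embi := ext_embedding hext; have fuse := ext_fuses_to.
move=> Ex; have [/imsetP[a _ ->]|nx] := boolP (x \in [set iota a | a : C]).
  by exists a.
have := ext_minimal hext; rewrite (total_dim2E fuse ext_psi_neq1 (ext_modular hext)).
have two0 : (2 : K) != 0 by rewrite pnatr_eq0.
move=> /(mulfI two0); rewrite (bigID (mem [set iota a | a : C])) /=.
rewrite (eq_bigl (mem [set iota a | a : C])) => [|y]; last first.
  rewrite andbC /=; case: imsetP => // -[a _ ->]; by rewrite ext_eps eqxx.
rewrite big_imset => [|a b _ _ /(obj_inj embi)//].
rewrite /total_dim2 [X in X + _](eq_bigr (fun a => qdim a ^+ 2)) => [|a _]; last first.
  by rewrite (emb_qdim embi).
rewrite -[RHS]addr0 => /addrI/eqP; rewrite psumr_eq0 => [|y _]; last first.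
  by rewrite exprn_ge0 ?ltW ?qdim_gt0.
move=> /allP/(_ x); rewrite mem_index_enum Ex eqxx nx => /(_ isT) /=.
by rewrite sqrf_eq0 (negPf (qdim_neq0 x)).
Qed.

(** * Autoequivalences with trivial restriction *)

Variable rho : functor_data Cv Cv.
Hypothesis hrho : braided_embedding rho.
Hypothesis hker : in_ker_r psi iota rho.

Lemma ker_r_fixes (a : C) : rho (iota a) = iota a.
Proof.
have [rho' [_ [_ /(_ a) /= -> _] [g [_ _ [_ /(_ a) /= -> _]]]]] := hker.
by [].
Qed.

Lemma ker_r_linear : anti rho = false.
Proof.
have [rho' [_ [/= E _ _] [g [_ _ [/= E' _ _]]]]] := hker.
by move: E; rewrite E' (ext_linear hext) addbF.
Qed.

(** Even rows [a] are fixed by [rho], so invariance of [S] gives [S a (rho x) = S a x] there. *)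
Lemma ker_r_orbit (x : Cv) : rho x = x \/ rho x = mulpsi (iota psi) x.
Proof.
apply: (even_Smatrix_sep ext_fuses_to (ext_modular hext)) => _ /ext_even_image[a ->].
by rewrite -{1}(ker_r_fixes a) aut_Smatrix // ker_r_linear.
Qed.

Lemma ker_r_linked (x y : Cv) : vortex (iota psi) x -> vortex (iota psi) y ->
  Smatrix x y != 0 -> (rho x != x) = (rho y != y).
Proof.
have fuse := ext_fuses_to.
rewrite !(vortexE fuse) => /eqP Ex /eqP Ey S0.
have := aut_Smatrix x y hrho ker_r_linear.
have neg : - Smatrix x y != Smatrix x y.
  by rewrite eq_sym -addr_eq0 -mulr2n mulrn_eq0 negb_or S0.
have [rx|nx] := eqVneq (rho x) x; have [ry|ny] := eqVneq (rho y) y => //.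
- case: (ker_r_orbit y) => [/eqP|ry']; first by rewrite (negPf ny).
  by rewrite rx ry' Smatrix_mulpsir // Ex mulN1r => /eqP; rewrite (negPf neg).
- case: (ker_r_orbit x) => [/eqP|rx']; first by rewrite (negPf nx).
  by rewrite ry rx' Smatrix_mulpsil // Ey mulN1r => /eqP; rewrite (negPf neg).
Qed.

Lemma ker_r_same_block (x y : Cv) :
  same_block (iota psi) x y -> (rho x != x) = (rho y != y).
Proof.
move=> /connectP[p]; elim: p x => [|z p IH] x /= => [_ -> //|].
move=> /andP[/and3P[/andP[vx _] /andP[vz _] S0] pz yE].
rewrite -(IH z pz yE); case/orP: S0 => S0; first exact: ker_r_linked.
by apply/esym/ker_r_linked.
Qed.

End MinimalExtension.

Local Open Scope complex_scope.

Theorem theoremI6 (R : realType) (C Cv : ubfc R[i]) (psi : C)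
    (iota : functor_data C Cv)
    (hext : minimal_modular_extension psi iota)
    (k : nat) (hk : #|vv_blocks (iota psi)| = k)
    (rho : functor_data Cv Cv) (hrho : autLR (iota psi) rho)
    (hker : in_ker_r psi iota rho) :
  exists q : Cv -> bool,
    (forall x : Cv, vortex (iota psi) x ->
       fuses_to x (psi_pow (iota psi) (q x)) (rho x)) /\
    (forall x y : Cv, v_type (iota psi) x -> v_type (iota psi) y ->
       same_block (iota psi) x y -> q x = q y).
Proof.
have braided := autLR_braided hrho.
(* [q] records whether [rho] moves [x]; on [sigma]-type vortices it is false, as there [mulpsi]
   fixes [x]. *)
exists (fun x => rho x != x); split=> [x _|x y _ _]; last first.
  exact: (ker_r_same_block hext braided hker).
have [->|nx] := eqVneq (rho x) x; first by apply/forallP => c; rewrite fusN1r.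
case: (ker_r_orbit hext braided hker x) => [/eqP|->]; first by rewrite (negPf nx).
exact: fuses_to_mulpsi (ext_fuses_to hext) x.
Qed.
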